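(* Let $n\ge k\ge 1$ and let $\lambda=(\lambda_1,\ldots,\lambda_k)$ be a partition with $\lambda_1\ge\lambda_2\ge\cdots\ge\lambda_k\ge 0$ and $\lambda_1\le n-k$, and set $\lambda_{k+1}:=0$. Then the weight generating function $P_\lambda(\alpha,\beta)=\sum_T \mathrm{wt}(T)$, summed over all Condensed Catalan tableaux $T$ of size $(k,n)$ and shape $\lambda$, equals $$P_\lambda(\alpha,\beta)=\alpha^k\beta^{n-k}\det\big(A_{ij}\big)_{1\le i,j\le k},$$ where $$A_{ij}=\beta^{j-i}\alpha^{\lambda_i-\lambda_{j+1}}\left(\binom{\lambda_{j+1}}{j-i}+\beta\binom{\lambda_{j+1}}{j-i+1}\right)+\beta^{j-i}\alpha^{\lambda_i-\lambda_j}\sum_{\ell=0}^{\lambda_j-\lambda_{j+1}-1}\alpha^{\ell}\left(\binom{\lambda_j-\ell-1}{j-i-1}+\beta\binom{\lambda_j-\ell-1}{j-i}\right).$$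
   Context: Binomial coefficients $\binom{a}{b}$ (here always with $a\ge 0$) are $0$ when $b<0$ or $b>a$; an empty sum is $0$. The Young diagram of $\lambda$ (English convention) consists of boxes $(r,c)$ with $1\le r\le k$, $1\le c\le\lambda_r$ (row 1 on top, column 1 leftmost), viewed inside a $k\times(n-k)$ rectangle. A Condensed Catalan tableau of size $(k,n)$ and shape $\lambda$ is an assignment to each box of one of $\alpha$, $\beta$, or empty, such that: (ii) if box $(r,c)$ contains $\beta$, every box $(r,c')$ with $c'<c$ is empty; (iii) if box $(r,c)$ contains $\alpha$, every box $(r',c)$ with $r'<r$ is empty; (iv) every box $(r,c)$ such that there is no $\alpha$ in any box $(r',c)$ with $r'>r$ and no $\beta$ in any box $(r,c')$ with $c'>c$ contains $\alpha$ or $\beta$. Its weight is $\mathrm{wt}(T)=\alpha^{k+a}\beta^{n-k+b}$, where $a$ and $b$ are the numbers of $\alpha$'s and $\beta$'s in the filling. *)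

(* Defs.v *)
From HB Require Import structures.
From mathcomp Require Import all_boot all_order all_algebra.
Set Implicit Arguments. Unset Strict Implicit. Unset Printing Implicit Defensive.
Import Order.TTheory GRing.Theory Num.Theory.

Definition cell := option bool.
Definition cAlpha : cell := Some true.
Definition cBeta : cell := Some false.
Definition cEmpty : cell := None.

(* The partition lambda is given as a list lam = [lambda_1; ...; lambda_k];
   lamr lam r = lambda_r (1-based); lambda_{k+1} = 0 automatically. *)
Definition lamr (lam : seq nat) (r : nat) : nat := nth 0 lam r.-1.

(* Fillings of the k x (n-k) rectangle; box (i,j) (0-based ordinals)
   is the box (r,c) = (i+1, j+1). *)
Definition filling (k n : nat) := {ffun 'I_k * 'I_(n - k) -> cell}.

Definition in_shape (lam : seq nat) k n (x : 'I_k * 'I_(n - k)) : bool :=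
  (x.2 < nth 0 lam x.1)%N.

Definition is_CCT (k n : nat) (lam : seq nat) (T : filling k n) : bool :=
  [forall x, ~~ in_shape lam x ==> (T x == cEmpty)] &&
  [forall r : 'I_k, forall c : 'I_(n - k), forall c' : 'I_(n - k),
     [&& in_shape lam (r, c), T (r, c) == cBeta & (c' < c)%N] ==>
       (T (r, c') == cEmpty)] &&
  [forall r : 'I_k, forall c : 'I_(n - k), forall r' : 'I_k,
     [&& in_shape lam (r, c), T (r, c) == cAlpha & (r' < r)%N] ==>
       (T (r', c) == cEmpty)] &&
  [forall r : 'I_k, forall c : 'I_(n - k),
     [&& in_shape lam (r, c),
         [forall r' : 'I_k, (r < r')%N ==> (T (r', c) != cAlpha)] &
         [forall c' : 'I_(n - k), (c < c')%N ==> (T (r, c') != cBeta)]] ==>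
       (T (r, c) != cEmpty)].

Definition num_alpha k n (T : filling k n) : nat := #|[set x | T x == cAlpha]|.
Definition num_beta k n (T : filling k n) : nat := #|[set x | T x == cBeta]|.

Local Open Scope ring_scope.

Definition wt (R : ringType) (a b : R) k n (T : filling k n) : R :=
  a ^+ (k + num_alpha T) * b ^+ (n - k + num_beta T).

Definition binz (m : nat) (z : int) : nat :=
  match z with Posz p => 'C(m, p) | Negz _ => 0%N end.

(* The entry A_{ij} (1-based i, j); exponents are integers. *)
Definition Aent (R : fieldType) (a b : R) (lam : seq nat) (i j : nat) : R :=
  let L := lamr lam in
  b ^ (j%:Z - i%:Z) * a ^ ((L i)%:Z - (L j.+1)%:Z) *
    ((binz (L j.+1) (j%:Z - i%:Z))%:R + b * (binz (L j.+1) (j%:Z - i%:Z + 1))%:R)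
  + b ^ (j%:Z - i%:Z) * a ^ ((L i)%:Z - (L j)%:Z) *
    \sum_(0 <= l < L j - L j.+1)
      a ^+ l * ((binz (L j - l - 1) (j%:Z - i%:Z - 1))%:R
                + b * (binz (L j - l - 1) (j%:Z - i%:Z))%:R).

(* Main.v *)
Require Import Defs.
From mathcomp Require Import all_boot all_order all_algebra.
From mathcomp Require Import zify ring.
Import GRing.Theory Num.Theory.
Local Open Scope ring_scope.

(* Encode lambda by its south-east boundary, a word in V (vertical step) and
   H (horizontal step). Filling the rows from bottom to top and remembering only
   the number of columns without an alpha so far, one gets F with
   F(u V H v) = a F(u V v) + b F(u H v), and P_lambda = a^k b^(n-k) F(lambda).
   With h_j(m) = C(m,j-1) + b C(m,j), so that h_j(m+1) = h_j(m) + h_(j-1)(m),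
   a weighted sum U_j over the suffixes of a word satisfies
   U_j(u V H v) = U_j(u V v) + U_(j-1)(u V v) + b U_j(u H v),
   which evaluates U_j for j <= 0; U_0(lambda) = 0 is the identity
   F(lambda) = sum_j (-1)^(j-1) A_(1j) F(lambda_(j+1),...,lambda_k).
   Since A is upper Hessenberg with unit subdiagonal, this says that
   A sends the vector ((-1)^j F(lambda_(j+1),...))_j to F(lambda) e_1,
   and det A = F(lambda) follows by applying the adjugate. *)

(** * Boundary words, their weights and the corner recursion *)

Lemma nth_nonincr (lam : seq nat) i j : sorted geq lam -> (i <= j)%N ->
  (nth 0%N lam j <= nth 0%N lam i)%N.
Proof.
move=> Hs leij; have [ltj|gej] := ltnP j (size lam); last by rewrite nth_default.
have geq_trans : transitive geq by move=> x y z /= yx zy; apply: leq_trans zy yx.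
exact: (sorted_leq_nth geq_trans leqnn 0%N Hs i j (leq_ltn_trans leij ltj) ltj leij).
Qed.

(* Adds a row with [u] columns still free of alphas: from right to left, the cell
   in a free column is an alpha or the unique beta of the row; [g] is evaluated
   at the number of columns that are free afterwards. *)
Fixpoint row_op {R : fieldType} (a b : R) (g : nat -> R) (u : nat) : R :=
  if u is u'.+1 then a * row_op a b g u' + b * g u else g 0%N.

(* [true] is a vertical step (a row), [false] a horizontal one (a column); the
   word is read from the north-east end of the boundary. *)
Fixpoint path_sum {R : fieldType} (a b : R) (w : seq bool) (g : nat -> R) : R :=
  match w with
  | [::] => g 0%N
  | true :: v => path_sum a b v (row_op a b g)
  | false :: v => path_sum a b v (fun u => g u.+1)
  end.

Definition path_wt {R : fieldType} (a b : R) (w : seq bool) : R :=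
  path_sum a b w (fun=> 1).

Lemma eq_row_op {R : fieldType} (a b : R) g1 g2 :
  g1 =1 g2 -> row_op a b g1 =1 row_op a b g2.
Proof. by move=> eg; elim=> [|u /= ->]; rewrite ?eg //= eg. Qed.

Lemma eq_path_sum {R : fieldType} (a b : R) w g1 g2 :
  g1 =1 g2 -> path_sum a b w g1 = path_sum a b w g2.
Proof.
elim: w g1 g2 => [|[] v IH] g1 g2 eg /=; first exact: eg.
  by apply: IH; apply: eq_row_op.
by apply: IH => u; apply: eg.
Qed.

Lemma row_op_linear {R : fieldType} (a b c d : R) g1 g2 u :
  row_op a b (fun i => c * g1 i + d * g2 i) u =
  c * row_op a b g1 u + d * row_op a b g2 u.
Proof. by elim: u => [//|u /= ->]; ring. Qed.

Lemma path_sum_linear {R : fieldType} (a b c d : R) w g1 g2 :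
  path_sum a b w (fun i => c * g1 i + d * g2 i) =
  c * path_sum a b w g1 + d * path_sum a b w g2.
Proof.
elim: w g1 g2 => [//|[] v IH] g1 g2 /=; last exact: IH.
by rewrite -IH; apply: eq_path_sum => u; apply: row_op_linear.
Qed.

(** For empty [w] this is the successor clause of [row_op], carried through [v] by linearity; a
    prefix only changes [g]. *)
Lemma path_sum_corner {R : fieldType} (a b : R) w v g :
  path_sum a b (w ++ [:: true, false & v]) g =
  a * path_sum a b (w ++ true :: v) g + b * path_sum a b (w ++ false :: v) g.
Proof.
by elim: w g => [|[] w IH] g //=; rewrite -path_sum_linear; apply: eq_path_sum.
Qed.

Lemma path_wt_nseq {R : fieldType} (a b : R) m n :
  path_wt a b (nseq m false ++ nseq n true) = 1.
Proof.
rewrite /path_wt; elim: m => [|m //] /=.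
suff H g : path_sum a b (nseq n true) g = g 0%N by [].
by elim: n g => [//|n IH] g /=; rewrite IH.
Qed.

(** * Alternating sums over the suffixes of a word *)

Lemma binzS m z : binz m.+1 z = (binz m z + binz m (z - 1))%N.
Proof.
case: z => [[|z]|z] //=; first by rewrite !bin0.
by rewrite subn1 binS.
Qed.

Definition bin_coef {R : fieldType} (b : R) (j : int) (m : nat) : R :=
  (binz m (j - 1))%:R + b * (binz m j)%:R.

Lemma bin_coefS {R : fieldType} (b : R) j m :
  bin_coef b j m.+1 = bin_coef b j m + bin_coef b (j - 1) m.
Proof. by rewrite /bin_coef !binzS !natrD; ring. Qed.

Lemma bin_coef_neg {R : fieldType} (b : R) j m : j < 0 -> bin_coef b j m = 0.
Proof. by case: j => [//|j] _; rewrite /bin_coef /= mulr0 addr0 //; case: j. Qed.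

(* One term for each proper decomposition [w = u ++ s :: v]; [j] is shifted by the number
   of vertical steps of [u]. *)
Fixpoint alt_sum {R : fieldType} (a b : R) (w : seq bool) (j : int) : R :=
  match w with
  | [::] => bin_coef b j 0
  | true :: v =>
      a ^- count_mem false v * bin_coef b j (count_mem false v) *
        path_wt a b (true :: v) - b * alt_sum a b v (j + 1)
  | false :: v =>
      a ^- (count_mem false v).+1 * bin_coef b (j - 1) (count_mem false v) *
        path_wt a b v + alt_sum a b v j
  end.

(** For a cut before the corner, [path_sum_corner] splits the weight of the suffix. The part from
    [w ++ true :: v] counts one horizontal step fewer, which absorbs the factor [a], and Pascal's
    rule [bin_coefS] spreads it over [j] and [j - 1]. *)
Lemma alt_sum_corner {R : fieldType} (a b : R) w v j : a != 0 ->
  alt_sum a b (w ++ [:: true, false & v]) j =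
  alt_sum a b (w ++ true :: v) j + alt_sum a b (w ++ true :: v) (j - 1) +
  b * alt_sum a b (w ++ false :: v) j.
Proof.
move=> a0; elim: w j => [|s w IH] j.
  rewrite /= !add1n bin_coefS subrK addrK exprS /path_wt.
  rewrite (path_sum_corner a b [::]) -!/(path_wt _ _ _).
  rewrite -[path_wt a b ([::] ++ false :: v)]/(path_wt a b v) cat0s.
  set x := a ^+ _; have x0 : x != 0 by rewrite expf_neq0.
  by field; exact/andP.
case: s => /=; rewrite IH !count_cat /= ?add0n ?add1n !addnS !bin_coefS.
  rewrite /path_wt -!cat_cons path_sum_corner subrK addrK !cat_cons.
  rewrite !exprS; set x := a ^+ _.
  have x0 : x != 0 by rewrite expf_neq0.
  by field; exact/andP.
rewrite /path_wt path_sum_corner !exprS; set x := a ^+ _.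
have x0 : x != 0 by rewrite expf_neq0.
by field; exact/andP.
Qed.

(** Separates the words without a corner, where [alt_sum] is computed directly, from those to which
    the corner recursion applies. *)
Lemma word_split (w : seq bool) :
  (exists m n, w = nseq m false ++ nseq n true) \/
  (exists u v, w = u ++ [:: true, false & v]).
Proof.
elim: w => [|s w [[m [n ->]]|[u [v ->]]]]; first by left; exists 0%N, 0%N.
  case: s; last by left; exists m.+1, n.
  case: m => [|m]; first by left; exists 0%N, n.+1.
  by right; exists [::], (nseq m false ++ nseq n true).
by right; exists (s :: u), v.
Qed.

(** Positive [j] must be included because each vertical step raises [j] by one. For [j = 0] and
    [p > 0] the contributions [b] and [- b * 1] cancel. *)
Lemma alt_sum_nseq {R : fieldType} (a b : R) p j :
  alt_sum a b (nseq p true) j =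
  if 1 < j then 0 else if j == 1 then 1
  else if j + p%:Z == 0 then (- b) ^+ p * b else 0.
Proof.
elim: p j => [|p IH] j /=.
  rewrite /bin_coef; case: j => [[|[|j]]|[|j]] //=; rewrite ?bin0n /= ?expr0; ring.
rewrite count_nseq mul0n expr0 invr1 mul1r -/(nseq p.+1 true).
rewrite (path_wt_nseq a b 0 p.+1) mulr1 IH /bin_coef exprS.
case: j => [[|[|j]]|[|j]] /=; rewrite ?addn1 ?bin0n /=; try ring.
- have -> : ((-1)%Z + 1 + p%:Z == 0) = ((-1)%Z + p.+1%:Z == 0) by lia.
  by case: ifP => _; ring.
have -> : (Negz j.+1 + 1 + p%:Z == 0) = (Negz j.+1 + p.+1%:Z == 0) by lia.
by case: ifP => _; ring.
Qed.

Lemma alt_sumE {R : fieldType} (a b : R) w j : a != 0 -> j <= 0 ->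
  alt_sum a b w j =
  if j + (count_mem true w)%:Z == 0 then (- b) ^+ count_mem true w * b else 0.
Proof.
move=> a0; have [n] := ubnP (size w); elim: n w j => // n IH w j ltn j0.
have [[m [p def_w]]|[u [v def_w]]] := word_split w.
  rewrite def_w count_cat !count_nseq /= mul0n mul1n add0n {ltn IH def_w}.
  (* Leading horizontal steps contribute nothing: their coefficient has index [j - 1 < 0]. *)
  elim: m => [|m /= ->]; last by rewrite bin_coef_neg ?mulr0 ?mul0r ?add0r //; lia.
  rewrite alt_sum_nseq; case: ifP; first lia.
  by case: ifP; first lia.
rewrite def_w alt_sum_corner // !IH //; first last.
- by move: ltn; rewrite def_w !size_cat /=; lia.
- by lia.
- by move: ltn; rewrite def_w !size_cat /=; lia.
- by move: ltn; rewrite def_w !size_cat /=; lia.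
rewrite !count_cat /= ?add1n ?add0n !addnS !exprS.
set c := (_ + _)%N.
(* The last two summands of the recursion are now nonzero only for [j + c = 0], and there they are
   opposite. *)
have -> : (j - 1 + c.+1%:Z == 0) = (j + c%:Z == 0) by lia.
case: ifP => h1; case: ifP => h2; try lia; ring.
Qed.

(** * From words to partitions: the recursion for the shape weight *)

Fixpoint boundary (lam : seq nat) : seq bool :=
  if lam is l :: lam' then
    true :: nseq (l - head 0%N lam') false ++ boundary lam'
  else [::].

Lemma count_boundaryF lam : sorted geq lam ->
  count_mem false (boundary lam) = head 0%N lam.
Proof.
elim: lam => [//|l lam IH] /= Hs; rewrite count_cat count_nseq mul1n.
rewrite IH ?(path_sorted Hs) //; case: lam Hs {IH} => [|l' lam] /=; lia.
Qed.

Definition shape_wt {R : fieldType} (a b : R) (lam : seq nat) : R :=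
  path_wt a b (boundary lam).

(** The total coefficient of one shape weight in [alt_sum]: the horizontal steps before a row do not
    change the weight of the suffix, so their terms join that of the vertical step which follows
    them. *)
Definition coefB {R : fieldType} (a b : R) (j : int) (l l' : nat) : R :=
  a ^- l' * bin_coef b j l' +
  \sum_(l' <= m < l) a ^- m.+1 * bin_coef b (j - 1) m.

Lemma path_wt_nseq_cat {R : fieldType} (a b : R) d w :
  path_wt a b (nseq d false ++ w) = path_wt a b w.
Proof. by elim: d. Qed.

Lemma alt_sum_nseq_cat {R : fieldType} (a b : R) d w j :
  alt_sum a b (nseq d false ++ w) j =
  path_wt a b w * (\sum_(count_mem false w <= m < d + count_mem false w)
    a ^- m.+1 * bin_coef b (j - 1) m) + alt_sum a b w j.
Proof.
elim: d => [|d IH] /=; first by rewrite big_geq // mulr0 add0r.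
rewrite IH path_wt_nseq_cat count_cat count_nseq mul1n addSn.
rewrite big_nat_recr /=; last lia.
by ring.
Qed.

(** Groups the cuts by the number [i] of rows passed, each of which contributes a factor [- b] and
    raises [j] by one. The last index accounts for the empty suffix. *)
Lemma alt_sum_boundary {R : fieldType} (a b : R) l lam (j : int) : 1 <= j ->
  sorted geq (l :: lam) ->
  alt_sum a b (nseq (l - head 0%N lam) false ++ boundary lam) j =
  \sum_(i < (size lam).+1) (- b) ^+ i *
    coefB a b (j + i%:Z) (nth 0%N (l :: lam) i) (nth 0%N lam i) *
    shape_wt a b (drop i lam).
Proof.
elim: lam l j => [|l' lam IH] l j j1 Hs.
  rewrite alt_sum_nseq_cat big_ord1 /= /shape_wt /path_wt /coefB /= addr0 addn0 subn0.
  by rewrite expr0 invr1; ring.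
have Hs' := path_sorted Hs.
rewrite alt_sum_nseq_cat count_boundaryF // subnK; last by case/andP: Hs.
rewrite [alt_sum _ _ (boundary _) _]/=.
rewrite IH //; last lia.
have eqc : count_mem false (nseq (l' - head 0%N lam) false ++ boundary lam) = l'.
  by have := count_boundaryF _ Hs'; rewrite /= add0n.
rewrite eqc.
rewrite [RHS]big_ord_recl addrA; congr (_ + _).
  by rewrite -[true :: _]/(boundary (l' :: lam)) -/(shape_wt _ _ _) /= addr0 /coefB; ring.
rewrite mulr_sumr -sumrN; apply: eq_bigr => i _.
rewrite lift0 /= exprS.
have -> : j + i.+1%:Z = j + 1 + i%:Z by lia.
ring.
Qed.

(** The word starts with a vertical step, so its [alt_sum] at 0 vanishes. The first term is
    [a ^- l * b] times the wanted weight, and the rest is [- b] times an [alt_sum] at 1. *)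
Lemma shape_wt_rec {R : fieldType} (a b : R) l lam : a != 0 -> b != 0 ->
  sorted geq (l :: lam) ->
  shape_wt a b (l :: lam) =
  \sum_(i < (size lam).+1) (- b) ^+ i *
    (a ^+ l * coefB a b (1 + i%:Z) (nth 0%N (l :: lam) i) (nth 0%N lam i)) *
    shape_wt a b (drop i lam).
Proof.
move=> a0 b0 Hs.
have: alt_sum a b (boundary (l :: lam)) 0 = 0.
  by rewrite alt_sumE //=; case: ifP; lia.
rewrite /= add0r alt_sum_boundary //.
have := count_boundaryF _ Hs; rewrite /= add0n => ->.
rewrite -[true :: _]/(boundary (l :: lam)) -/(shape_wt _ _ _).
have -> : bin_coef b 0 l = b by rewrite /bin_coef /= bin0 mulr1 add0r.
move/eqP; rewrite subr_eq0 => /eqP E; apply: (mulfI b0).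
have -> : b * shape_wt a b (l :: lam) = a ^+ l * (a ^- l * b * shape_wt a b (l :: lam)).
  have x0 : a ^+ l != 0 by rewrite expf_neq0.
  by field.
rewrite E mulrCA; congr (_ * _); rewrite mulr_sumr.
by apply: eq_bigr => i _; ring.
Qed.

(** * The determinant *)

Lemma AentE {R : fieldType} (a b : R) lam i j : a != 0 ->
  (nth 0%N lam (i + j).+1 <= nth 0%N lam (i + j))%N ->
  Aent a b lam i.+1 (i + j).+1 =
  b ^+ j * (a ^+ nth 0%N lam i *
     coefB a b (1 + j%:Z) (nth 0%N lam (i + j)) (nth 0%N lam (i + j).+1)).
Proof.
move=> a0 le_l; rewrite /Aent /lamr /=; move: le_l.
set l := nth _ _ (_ + _).+1; set m := nth _ _ (_ + _); set p := nth _ _ i => le_l.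
have -> : (i + j).+1%:Z - i.+1%:Z = j%:Z by lia.
rewrite /coefB /bin_coef (addrC 1) addrK -exprnP !expfzDr // -!exprnP -!exprnN.
rewrite !(mulrDr (_ ^+ _)) (addrC j%:Z 1) -!mulrA; congr (_ + _).
congr (_ * _); congr (_ * _).
(* The sum in [Aent] is read backwards: its index is [m - (q + l) - 1], where [q + l] is the index
   in [coefB]. *)
rewrite -{2}[l]add0n big_addn big_nat_rev /= add0n.
rewrite mulr_sumr; apply: eq_big_nat => q /andP[_ ltq].
have -> : (m - l - q.+1)%N = (m - (q + l).+1)%N by lia.
have -> : (m - (m - (q + l).+1) - 1)%N = (q + l)%N by lia.
have {1}-> : m = ((m - (q + l).+1) + (q + l).+1)%N by lia.
rewrite exprD invfM; set x := a ^+ (m - _); set y := a ^+ (q + l).+1.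
have x0 : x != 0 by rewrite expf_neq0.
have y0 : y != 0 by rewrite expf_neq0.
by field; exact/andP.
Qed.

(** The recurrence for [G] makes [A] send the signed vector [v] to [G 0] times the first basis
    vector; the adjugate then yields the determinant without any division. *)
Lemma det_hessenberg {R : comPzRingType} k (A : 'M[R]_k.+1) (G : nat -> R) :
  (forall i j : 'I_k.+1, (j.+1 < i)%N -> A i j = 0) ->
  (forall i j : 'I_k.+1, i = j.+1 :> nat -> A i j = 1) ->
  G k.+1 = 1 ->
  (forall i : 'I_k.+1,
     G i = \sum_(j < k.+1 | (i <= j)%N) (-1) ^+ (j - i) * A i j * G j.+1) ->
  \det A = G 0%N.
Proof.
move=> A0 A1 Gk Gr.
pose v : 'cV[R]_k.+1 := \col_j ((-1) ^+ j * G j.+1).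
have Av : A *m v = \col_i (if i == ord0 then G 0%N else 0).
  apply/colP => i; rewrite !mxE; case: (eqVneq i ord0) => [->|i0].
    rewrite (Gr ord0); apply: eq_bigr => j _.
    by rewrite !mxE subn0 mulrCA mulrA.
  have i_gt0 : (0 < i)%N by rewrite lt0n.
  have lti : (i.-1 < k.+1)%N by rewrite (leq_ltn_trans (leq_pred _)).
  (* The subdiagonal entry contributes [G i] up to sign, which the recurrence cancels against the
     entries on and above the diagonal. *)
  rewrite (bigD1 (Ordinal lti)) //= !mxE A1 ?prednK // mul1r.
  rewrite (bigID (fun j : 'I__ => i <= j)%N) /= [X in _ + (_ + X)]big1; last first.
    move=> j /andP[ji]; rewrite -val_eqE /= in ji; rewrite -ltnNge => lji.
    by rewrite A0 ?mul0r // -(ltn_predK i_gt0) ltnS ltn_neqAle ji -ltnS prednK.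
  rewrite addr0 Gr mulr_sumr [X in _ + X](eq_bigl (fun j : 'I__ => i <= j)%N).
    rewrite -big_split /= big1 // => j lij; rewrite !mxE.
    have -> : (-1) ^+ j = (-1) ^+ i.-1 * (-1) * (-1) ^+ (j - i) :> R.
      by rewrite -exprSr prednK // -exprD subnKC.
    ring.
  by move=> j; rewrite andb_idl // -val_eqE /=; lia.
(* The last coordinate suffices: there [v] is a mere sign, since [G k.+1 = 1]. *)
have : (\adj A *m (A *m v)) ord_max ord0 = (\det A *: v) ord_max ord0.
  by rewrite mulmxA mul_adj_mx mul_scalar_mx.
rewrite Av !mxE (bigD1 ord0) //= big1 => [|i i0]; last first.
  by rewrite !mxE (negbTE i0) mulr0.
rewrite !mxE eqxx addr0 Gk mulr1 /cofactor add0n.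
(* Deleting the first row and the last column moves the subdiagonal to the diagonal and leaves a
   unitriangular minor. *)
suff -> : \det (row' ord0 (col' ord_max A)) = 1.
  by rewrite mulr1 [RHS]mulrC => /(can_inj (signrMK _)).
rewrite -det_tr det_trig.
  by apply: big1 => i _; rewrite !mxE A1 // lift0 lift_max.
by apply/is_trig_mxP => i j ij; rewrite !mxE A0 // lift0 lift_max ltnS.
Qed.

Lemma det_Aent {R : fieldType} (a b : R) lam : a != 0 -> b != 0 ->
  sorted geq lam ->
  \det (\matrix_(i < size lam, j < size lam) Aent a b lam i.+1 j.+1) =
  shape_wt a b lam.
Proof.
move=> a0 b0 Hs; case def_k: (size lam) => [|k].
  by rewrite (size0nil def_k) det_mx00.
have le_nth i : (nth 0%N lam i.+1 <= nth 0%N lam i)%N by apply: nth_nonincr.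
rewrite (@det_hessenberg _ _ _ (fun i => shape_wt a b (drop i lam))) ?drop0 //.
- move=> i j ij; rewrite mxE /Aent.
  have -> : j.+1%:Z - i.+1%:Z = Negz (i - j).-1 by lia.
  have -> : Negz (i - j).-1 + 1 = Negz (i - j).-2 by lia.
  have -> : Negz (i - j).-1 - 1 = Negz (i - j) by lia.
  by rewrite /= mulr0 addr0 mulr0 add0r big1 ?mulr0 // => l _; rewrite mulr0.
- move=> i j ij; rewrite mxE /Aent ij /lamr.
  (* On the subdiagonal only a binomial with lower index 0 survives; its factor [b] cancels [b^-1],
     and the exponent of [a] is 0. *)
  have -> : j.+1%:Z - j.+2%:Z = Negz 0 by lia.
  rewrite [_ + 1]/= [Negz 0 - 1]/= [_.+1.-1]/= subrr.
  rewrite [binz _ _]/= [binz _ 0]/= bin0 mulr1 add0r big1 => [|l _]; last first.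
    by rewrite mulr0 addr0 /= mulr0.
  by rewrite mulr0 addr0 mulr1 -[b ^ _]/(b^-1) mulVf.
- by rewrite drop_oversize ?def_k.
move=> i; rewrite (drop_nth 0%N) ?def_k // shape_wt_rec //; last first.
  by rewrite -drop_nth ?def_k // drop_sorted.
rewrite size_drop def_k subSS.
pose F j := (-1) ^+ (j - i) * Aent a b lam i.+1 j.+1 * shape_wt a b (drop j.+1 lam).
transitivity (\sum_(i <= j < k.+1) F j); last first.
  by rewrite big_geq_mkord; apply: eq_big => // j _; rewrite mxE.
have -> : \sum_(i <= j < k.+1) F j = \sum_(q < (k - i).+1) F (q + i)%N.
  by rewrite -[X in \sum_(X <= _ < _) _]add0n big_addn big_mkord subSn // -ltnS.
apply: eq_bigr => q _; rewrite /F addnK (addnC q) AentE // drop_drop.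
rewrite nth_drop -drop_nth ?def_k // nth_drop addSn [in LHS]exprNn addnS addnC.
by rewrite !mulrA.
Qed.

(** * Generating function of a single row *)

(** [B] stands for the columns that meet the row and have no alpha below it. *)
Definition row_valid {N} (B : {set 'I_N}) (w : {ffun 'I_N -> cell}) : bool :=
  [forall c, (w c != cEmpty) ==
     (c \in B) && [forall c' : 'I_N, (c < c')%N ==> (w c' != cBeta)]].

(* The valid rows are indexed by the position of their beta, if any. *)
Definition row_of {N} (B : {set 'I_N}) (p : option 'I_N) : {ffun 'I_N -> cell} :=
  [ffun c => if c \notin B then cEmpty
             else if p is Some q then
               if c == q then cBeta else if (c < q)%N then cEmpty else cAlpha
             else cAlpha].

Definition row_beta {N} (w : {ffun 'I_N -> cell}) : option 'I_N :=
  [pick c | w c == cBeta].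

Lemma row_of_valid {N} (B : {set 'I_N}) p : oapp (fun q => q \in B) true p ->
  row_valid B (row_of B p).
Proof.
case: p => [q|] /= Bq; apply/forallP => c; rewrite !ffunE;
  case: (boolP (c \in B)) => // cB /=.
  have [->|cq] /= := eqVneq c q.
    apply/eqP/esym/forallP => c'; apply/implyP => ltc; rewrite ffunE.
    case: (_ \in _) => //=; have [e|_] := eqVneq c' q; first by rewrite e ltnn in ltc.
    by case: ifP.
  case: ltngtP => [lcq|lqc|/val_inj e] /=; last by rewrite e eqxx in cq.
    apply/eqP/esym/negbTE/forallPn; exists q.
    by rewrite lcq ffunE Bq /= eqxx.
  apply/eqP/esym/forallP => c'; apply/implyP => ltc; rewrite ffunE.
  case: (_ \in _) => //=; have [e|_] := eqVneq c' q; first by rewrite e in ltc; lia.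
  by case: ifP.
apply/eqP/esym/forallP => c'; apply/implyP => ltc; rewrite ffunE.
by case: (_ \in _).
Qed.

(** A beta empties all cells to its left, hence is unique; the cells of [B] to its right see no beta
    and must be alphas. *)
Lemma row_validE {N} (B : {set 'I_N}) w : row_valid B w ->
  oapp (fun q => q \in B) true (row_beta w) && (row_of B (row_beta w) == w).
Proof.
move=> /forallP Hv; rewrite /row_beta; case: pickP => [q /eqP wq|nob] /=.
  have := Hv q; rewrite wq /= => /eqP/esym/andP[qB /forallP Hq]; rewrite qB /=.
  apply/eqP/ffunP => c; rewrite ffunE; have := Hv c.
  case: (c \in B) => /=; last by case: (w c).
  have [->|ncq] := eqVneq c q; first by rewrite wq.
  case: ifP => [lcq|nlcq] /eqP.
    move/esym; have /negP nf : ~ [forall c' : 'I_N, (c < c')%N ==> (w c' != cBeta)].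
      by move/forallP/(_ q); rewrite lcq wq.
    by rewrite (negbTE nf) => /esym/negbFE/eqP.
  have lqc : (q < c)%N by rewrite ltn_neqAle leqNgt nlcq eq_sym ncq.
  have -> : [forall c' : 'I_N, (c < c')%N ==> (w c' != cBeta)].
    apply/forallP => c'; apply/implyP => lcc'.
    by have := Hq c'; rewrite (ltn_trans lqc lcc').
  by have := Hq c; rewrite lqc /=; case: (w c) => [[]|].
apply/eqP/ffunP => c; rewrite ffunE; have := Hv c.
have -> : [forall c' : 'I_N, (c < c')%N ==> (w c' != cBeta)].
  by apply/forallP => c'; rewrite nob implybT.
have := nob c; case: (c \in B) => /=; by case: (w c) => [[]|].
Qed.

Definition row_alphas {N} (w : {ffun 'I_N -> cell}) := [set c | w c == cAlpha].
Definition row_betas {N} (w : {ffun 'I_N -> cell}) := [set c | w c == cBeta].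

Lemma row_op_sum {R : fieldType} (a b : R) N (B : {set 'I_N}) g :
  a ^+ #|B| * g 0%N +
  \sum_(p in B) a ^+ #|[set c in B | (p < c)%N]| * b *
     g (#|B| - #|[set c in B | (p < c)%N]|)%N = row_op a b g #|B|.
Proof.
have [n] := ubnP #|B|; elim: n B => // n IH B ltB.
have [->|[p0 p0B]] := set_0Vmem B.
  by rewrite big_set0 cards0 /= expr0 mul1r addr0.
(* The rightmost free column is decided first: a beta there empties the rest, an alpha leaves the
   same problem on [B :\ p]. *)
have [p pB pmax] := @arg_maxnP _ p0 (fun p => p \in B) (@nat_of_ord N) p0B.
have cB : #|B| = #|B :\ p|.+1 by rewrite (cardsD1 p) pB.
rewrite (big_setD1 p) //= cB /= -IH; last by move: ltB; rewrite cB.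
have -> : [set c in B | (p < c)%N] = set0.
  apply/setP => c; rewrite !inE; apply/negP => /andP[cB' ltpc].
  by have := pmax _ cB' => /=; rewrite leqNgt ltpc.
rewrite cards0 subn0 expr0 mul1r addrCA addrC exprS mulrDr mulr_sumr mulrA.
congr (_ + _ + _); apply: eq_bigr => q; rewrite !inE => /andP[neq qB].
have ltqp : (q < p)%N by rewrite ltn_neqAle neq; apply: pmax.
have -> : #|[set c in B | (q < c)%N]| = #|[set c in B :\ p | (q < c)%N]|.+1.
  rewrite (cardsD1 p) !inE pB ltqp add1n; congr _.+1; apply: eq_card => c.
  by rewrite !inE andbA.
by rewrite subSS exprS !mulrA.
Qed.

Lemma sum_row_valid {R : fieldType} (a b : R) N (B : {set 'I_N}) g :
  \sum_(w | row_valid B w)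
     a ^+ #|row_alphas w| * b ^+ #|row_betas w| * g (#|B| - #|row_alphas w|)%N =
  row_op a b g #|B|.
Proof.
rewrite (reindex_onto (row_of B) row_beta) /=; last first.
  by move=> w /row_validE/andP[_ /eqP].
rewrite (eq_bigl (fun p => oapp (fun q => q \in B) true p)); last first.
  move=> p; apply/andP/idP => [[/row_validE/andP[] + _ /eqP e]|Bp].
    by rewrite e.
  split; first exact: row_of_valid.
  rewrite /row_beta; case: pickP => [c|].
    rewrite ffunE; case: ifP => //= _; case: p Bp => //= q _.
    by have [->|] := eqVneq c q => //; case: ifP.
  by case: p Bp => //= q Bq /(_ q); rewrite ffunE Bq eqxx.
rewrite -row_op_sum (bigD1 None) //=; congr (_ + _).
  have -> : row_alphas (row_of B None) = B.
    by apply/setP => c; rewrite !inE ffunE; case: (c \in B).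
  have -> : row_betas (row_of B None) = set0.
    by apply/setP => c; rewrite !inE ffunE; case: (c \in B).
  by rewrite cards0 mulr1 subnn.
rewrite (reindex_omap Some id) /=; last by case.
apply: eq_big => [q|q qB]; first by rewrite eqxx !andbT.
have -> : row_alphas (row_of B (Some q)) = [set c in B | (q < c)%N].
  apply/setP => c; rewrite !inE ffunE; case: (c \in B) => //=.
  by have [->|n] := eqVneq c q; [rewrite ltnn|rewrite -val_eqE in n; case: ltngtP n].
have -> : row_betas (row_of B (Some q)) = [set q].
  apply/setP => c; rewrite !inE ffunE; case: (boolP (c \in B)) => //= cB.
    by have [|] := eqVneq c q => //; case: ifP.
  by apply/esym/negP => /eqP e; move: qB; rewrite -e (negbTE cB).
by rewrite cards1 expr1.
Qed.

(** * Tableaux as stacks of rows *)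

Definition tab_valid {k N} (lam : seq nat) (T : {ffun 'I_k * 'I_N -> cell}) : bool :=
  [forall r : 'I_k, forall c : 'I_N, (T (r, c) != cEmpty) ==
    [&& (c < nth 0%N lam r)%N,
        [forall r' : 'I_k, (r < r')%N ==> (T (r', c) != cAlpha)] &
        [forall c' : 'I_N, (c < c')%N ==> (T (r, c') != cBeta)]]].

(** One equivalence per cell suffices: its forward direction gives the shape condition, (ii) and
    (iii), and its converse is (iv). *)
Lemma is_CCT_valid k n lam (T : filling k n) : is_CCT lam T = tab_valid lam T.
Proof.
apply/idP/idP => [/andP[/andP[/andP[/forallP H1 /forallP H2] /forallP H3] /forallP H4]|].
  have shp r c : T (r, c) != cEmpty -> in_shape lam (r, c).
    by have := H1 (r, c); case: in_shape => //= ->.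
  apply/forallP => r; apply/forallP => c; apply/eqP.
  apply/idP/idP => [Trc|/and3P[h1 h2 h3]].
    apply/and3P; split; first exact: (shp r c).
      apply/forallP => r'; apply/implyP => ltr; apply/negP => Ta.
      have := H3 r' => /forallP/(_ c)/forallP/(_ r); rewrite Ta ltr shp ?(eqP Ta) //=.
      by rewrite (negbTE Trc).
    apply/forallP => c'; apply/implyP => ltc; apply/negP => Ta.
    have := H2 r => /forallP/(_ c')/forallP/(_ c); rewrite Ta ltc shp ?(eqP Ta) //=.
    by rewrite (negbTE Trc).
  by have := H4 r => /forallP/(_ c)/implyP; apply; rewrite /in_shape h1 h2 h3.
move=> /forallP H; have {}H r c : (T (r, c) != cEmpty) =
    [&& (c < nth 0%N lam r)%N,
        [forall r' : 'I_k, (r < r')%N ==> (T (r', c) != cAlpha)] &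
        [forall c' : 'I_(n - k), (c < c')%N ==> (T (r, c') != cBeta)]].
  by have := H r => /forallP/(_ c)/eqP.
apply/andP; split; [apply/andP; split; [apply/andP; split|]|].
- apply/forallP => -[r c]; apply/implyP; rewrite /in_shape /= => nrc.
  by apply: negbFE; rewrite H (negbTE nrc).
- apply/forallP => r; apply/forallP => c; apply/forallP => c'; apply/implyP.
  case/and3P => _ Tb ltc; apply: negbFE; rewrite H; apply/negP => /and3P[_ _].
  by move/forallP/(_ c); rewrite ltc Tb.
- apply/forallP => r; apply/forallP => c; apply/forallP => r'; apply/implyP.
  case/and3P => _ Tb ltc; apply: negbFE; rewrite H; apply/negP => /and3P[_].
  by move/forallP/(_ r); rewrite ltc Tb.
- apply/forallP => r; apply/forallP => c; apply/implyP.
  by case/and3P => h1 h2 h3; rewrite H h2 h3 -/(in_shape lam (r, c)) h1.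
Qed.

Definition alpha_cols {k N} (T : {ffun 'I_k * 'I_N -> cell}) : {set 'I_N} :=
  [set c | [exists r, T (r, c) == cAlpha]].

Definition add_row {k N} (p : {ffun 'I_N -> cell} * {ffun 'I_k * 'I_N -> cell}) :
    {ffun 'I_k.+1 * 'I_N -> cell} :=
  [ffun x => if unlift ord0 x.1 is Some r then p.2 (r, x.2) else p.1 x.2].

Definition cut_row {k N} (T : {ffun 'I_k.+1 * 'I_N -> cell}) :
    {ffun 'I_N -> cell} * {ffun 'I_k * 'I_N -> cell} :=
  ([ffun c => T (ord0, c)], [ffun x => T (lift ord0 x.1, x.2)]).

Lemma add_rowK {k N} : cancel (@add_row k N) cut_row.
Proof.
case=> w T; congr pair; apply/ffunP => x; rewrite !ffunE /= ?unlift_none ?liftK //.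
by case: x.
Qed.

Lemma cut_rowK {k N} : cancel (@cut_row k N) add_row.
Proof.
move=> T; apply/ffunP => -[r c]; rewrite ffunE /=.
by case: unliftP => [r' ->|->]; rewrite !ffunE.
Qed.

Lemma add_row0 {k N} w T c : @add_row k N (w, T) (ord0, c) = w c.
Proof. by rewrite ffunE /= unlift_none. Qed.

Lemma add_rowS {k N} w T r c : @add_row k N (w, T) (lift ord0 r, c) = T (r, c).
Proof. by rewrite ffunE /= liftK. Qed.

Lemma card_add_row {k N} w T v :
  #|[set x | @add_row k N (w, T) x == v]| =
  (#|[set c | w c == v]| + #|[set x | T x == v]|)%N.
Proof.
have E j (S : {ffun 'I_j * 'I_N -> cell}) :
    #|[set x | S x == v]| = (\sum_(r < j) \sum_(c < N) (S (r, c) == v))%N.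
  rewrite pair_bigA /= -sum1_card big_mkcond /=; apply: eq_bigr => -[r c] _.
  by rewrite inE; case: eqP.
rewrite !E big_ord_recl; congr (_ + _)%N.
  rewrite -sum1_card [RHS]big_mkcond /=; apply: eq_bigr => c _.
  by rewrite inE add_row0; case: eqP.
by apply: eq_bigr => r _; apply: eq_bigr => c _; rewrite add_rowS.
Qed.

Lemma forall_ordS k (P : pred 'I_k.+1) :
  [forall r, P r] = P ord0 && [forall r, P (lift ord0 r)].
Proof.
apply/forallP/andP => [H|[P0 /forallP H] r]; last by case: (unliftP ord0 r) => [r' ->|->].
by split=> //; apply/forallP.
Qed.

Lemma alpha_cols_add_row {k N} w T :
  alpha_cols (@add_row k N (w, T)) = row_alphas w :|: alpha_cols T.
Proof.
apply/setP => c; rewrite !inE; apply: negb_inj; rewrite negb_or !negb_exists.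
rewrite forall_ordS add_row0; congr (_ && _).
by apply: eq_forallb => r; rewrite add_rowS.
Qed.

(** Alphas are sought only below a cell and betas only in its own row, so the lower rows do not see
    the new top row. *)
Lemma tab_valid_add_row {k N} l lam w T :
  tab_valid (l :: lam) (@add_row k N (w, T)) =
  tab_valid lam T && row_valid [set c : 'I_N | (c < l)%N & c \notin alpha_cols T] w.
Proof.
rewrite /tab_valid forall_ordS andbC; congr (_ && _).
  apply: eq_forallb => r; apply: eq_forallb => c; rewrite add_rowS.
  rewrite forall_ordS /=; congr (_ == [&& _, _ & _]).
    by apply: eq_forallb => r'; rewrite add_rowS.
  by apply: eq_forallb => c'; rewrite add_rowS.
apply: eq_forallb => c; rewrite add_row0 forall_ordS /= !inE negb_exists -andbA.
congr (_ == [&& _, _ & _]).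
  by apply: eq_forallb => r'; rewrite add_rowS.
by apply: eq_forallb => c'; rewrite add_row0.
Qed.

Lemma alpha_cols_sub {k N} lam (T : {ffun 'I_k * 'I_N -> cell}) c :
  sorted geq lam -> tab_valid lam T -> c \in alpha_cols T -> (c < head 0%N lam)%N.
Proof.
move=> Hs /forallP HT; rewrite inE => /existsP[r /eqP Tr].
have := HT r => /forallP/(_ c); rewrite Tr => /eqP/esym/and3P[ltc _ _].
by apply: leq_trans ltc _; rewrite -nth0; apply: nth_nonincr.
Qed.

(** [g] is arbitrary because removing the top row replaces it by [row_op a b g], up to a shift of
    the argument. *)
Lemma tab_sum {R : fieldType} (a b : R) N lam g :
  sorted geq lam -> (head 0%N lam <= N)%N ->
  \sum_(T : {ffun 'I_(size lam) * 'I_N -> cell} | tab_valid lam T)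
     a ^+ #|[set x | T x == cAlpha]| * b ^+ #|[set x | T x == cBeta]| *
     g (head 0%N lam - #|alpha_cols T|)%N =
  path_sum a b (boundary lam) g.
Proof.
elim: lam g => [|l lam IH] g Hs leN /=.
  have uniqT (T : {ffun 'I_0 * 'I_N -> cell}) : T = [ffun=> cEmpty].
    by apply/ffunP => -[[]].
  rewrite (big_pred1 [ffun=> cEmpty]) => [|T]; last first.
    by rewrite [T in RHS]uniqT /= eqxx; apply/forallP => -[].
  have E0 (A : {set 'I_0 * 'I_N}) : #|A| = 0%N.
    by apply: eq_card0 => -[[]].
  by rewrite !E0 !expr0 !mul1r sub0n.
have Hs' := path_sorted Hs.
have lel : (head 0%N lam <= l)%N by case: (lam) Hs => //= l' lam' /andP[].
(* The columns in which the top row exceeds the next one are all free. *)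
have -> h : path_sum a b (nseq (l - head 0%N lam) false ++ boundary lam) h =
    path_sum a b (boundary lam) (fun u => h (u + (l - head 0%N lam))%N).
  elim: (l - _)%N h => [|d IHd] h /=; first by apply: eq_path_sum => u; rewrite addn0.
  by rewrite IHd; apply: eq_path_sum => u; rewrite addnS.
rewrite -IH // 1?(leq_trans lel) //.
rewrite (reindex add_row) /=; last first.
  exact: (onW_bij _ (Bijective add_rowK cut_rowK)).
pose B (T : {ffun 'I_(size lam) * 'I_N -> cell}) :=
  [set c : 'I_N | (c < l)%N & c \notin alpha_cols T].
pose term := fun (w : {ffun 'I_N -> cell}) (T : {ffun 'I_(size lam) * 'I_N -> cell}) =>
  a ^+ #|[set x | T x == cAlpha]| * b ^+ #|[set x | T x == cBeta]| *
  (a ^+ #|row_alphas w| * b ^+ #|row_betas w| * g (#|B T| - #|row_alphas w|)%N).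
have cardB T : tab_valid lam T ->
    [/\ #|B T| = (l - #|alpha_cols T|)%N & (#|alpha_cols T| <= head 0%N lam)%N].
  move=> vT; have sub := alpha_cols_sub _ _ _ Hs' vT.
  have card_lt m : (m <= N)%N -> #|[set c : 'I_N | (c < m)%N]| = m.
    move=> lem; rewrite -sum1_card (eq_bigl (fun c : 'I_N => c < m)%N) => [|c].
      by rewrite (big_ord_narrow lem) sum1_card card_ord.
    by rewrite inE.
  split; last first.
    rewrite -[X in (_ <= X)%N](card_lt _ (leq_trans lel leN)); apply: subset_leq_card.
    by apply/subsetP => c /sub; rewrite inE.
  rewrite -[X in (X - _)%N](card_lt l leN) -cardsDS.
    by apply: eq_card => c; rewrite !inE andbC.
  by apply/subsetP => c /sub; rewrite inE => /leq_trans; apply.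
rewrite (eq_bigl (fun p => tab_valid lam p.2 && row_valid (B p.2) p.1)); last first.
  by case=> w T; rewrite tab_valid_add_row.
transitivity (\sum_(T | tab_valid lam T) \sum_(w | row_valid (B T) w) term w T).
  rewrite pair_big_dep /= (reindex (fun p => (p.2, p.1))) /=; last first.
    by apply: onW_bij; exists (fun p => (p.2, p.1)); case.
  apply: eq_bigr => -[T w] /= /andP[vT /forallP vw].
  (* New alphas stand in columns without alphas, so the numbers of occupied columns add up. *)
  have disj : [disjoint row_alphas w & alpha_cols T].
    apply/pred0P => c /=; apply/negP => /andP[]; rewrite inE => /eqP wc cT.
    by have := vw c; rewrite wc /= inE cT andbF.
  rewrite !card_add_row -/(row_alphas w) -/(row_betas w) alpha_cols_add_row.
  rewrite cardsU (disjoint_setI0 disj) cards0 subn0 (addnC _ #|alpha_cols T|) subnDA.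
  rewrite /term (cardB T vT).1 !exprD mulrACA.
  by rewrite [X in X * _]mulrC [RHS]mulrA.
apply: eq_bigr => T vT; have [cB leA] := cardB T vT.
rewrite -mulr_sumr sum_row_valid cB; congr (_ * row_op _ _ _ _).
by rewrite addnBAC // subnKC.
Qed.

Theorem theorem5p1 (R : fieldType) (a b : R) (k n : nat) (lam : seq nat) :
  a != 0 -> b != 0 ->
  (1 <= k)%N -> (k <= n)%N ->
  size lam = k -> sorted geq lam -> (head 0%N lam <= n - k)%N ->
  \sum_(T : filling k n | is_CCT lam T) wt a b T =
  a ^+ k * b ^+ (n - k) *
    \det (\matrix_(i < k, j < k) Aent a b lam i.+1 j.+1).
Proof.
move=> a0 b0 _ _ <- Hs leN.
(* The constant function 1 serves as [g] in [tab_sum]. *)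
rewrite det_Aent // /shape_wt /path_wt -(tab_sum a b (n - size lam)) // mulr_sumr.
apply: eq_big => [T|T _]; first exact: is_CCT_valid.
by rewrite /wt !exprD mulr1; ring.
Qed.
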